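(* Let $a,b$ be relatively prime positive integers. For every $t\in\mathbb{Z}$, \[\left|R_{\{a,1,b\}}(t+a+b)-R_{\{a,1,b\}}(t)\right|\le 1-\frac12\left(\frac1a+\frac1b\right).\]
   Context: $R_{\{a,1,b\}}(t):=S_{(1,b;a)}(t)+S_{(a,b;1)}(t)+S_{(a,1;b)}(t)$, where for an integer $c\ge1$ and positive integers $e_1,e_2$ coprime to $c$, $S_{(e_1,e_2;c)}(n)=\frac1c\sum_{j=1}^{c-1}\frac{\xi_c^{jn}}{(1-\xi_c^{je_1})(1-\xi_c^{je_2})}$ with $\xi_c=e^{2\pi i/c}$ (an empty sum, $0$, when $c=1$; in particular $S_{(a,b;1)}=0$). *)

(* Defs.v *)
From mathcomp Require Import all_boot all_order all_algebra.
From mathcomp Require Import all_classical all_reals all_analysis.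
From mathcomp Require Import complex.

Set Implicit Arguments.
Unset Strict Implicit.
Unset Printing Implicit Defensive.

Import Order.TTheory GRing.Theory Num.Theory.
Local Open Scope ring_scope.
Local Open Scope complex_scope.

(* e^(2 pi i / c), by Euler's formula *)
Definition xi (R : realType) (c : nat) : R[i] :=
  cos (2 * pi / c%:R) +i* sin (2 * pi / c%:R).

(* S_(e1, e2; c)(n); meaningful for c >= 1 and e1, e2 positive and coprime to c,
   in which case no denominator vanishes. *)
Definition fourier_dedekind (R : realType) (e1 e2 c : nat) (n : int) : R[i] :=
  c%:R^-1 *
  \sum_(1 <= j < c)
     xi R c ^ (j%:Z * n) /
       ((1 - xi R c ^+ (j * e1)) * (1 - xi R c ^+ (j * e2))).

Definition fourier_dedekind_sum (R : realType) (a b : nat) (t : int) : R[i] :=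
  fourier_dedekind R 1 b a t + fourier_dedekind R a b 1 t
  + fourier_dedekind R a 1 b t.

(* Main.v *)
(* Writing z = e^(2 pi i / c), the shift by a + b cancels one factor of each
   denominator, leaving - (1/c) * sum_(0 < j < c) z^(jt) / (1 - z^j) for c = a
   and for c = b. Without the factor 1/c, this sum is a sawtooth in t: it equals
   -(c-1)/2 at t = 1 by the symmetry j -> c - j, and it grows by 1 at each step
   until t = c, since the powers of a nontrivial c-th root of unity sum to 0.
   Hence it is at most (c-1)/2 in absolute value. *)
Require Import Defs.
From mathcomp Require Import all_boot all_order all_algebra.
From mathcomp Require Import all_classical all_reals all_analysis.
From mathcomp Require Import complex.
From mathcomp Require Import ring lra zify.
Import Order.TTheory GRing.Theory Num.Theory.
Local Open Scope ring_scope.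
Local Open Scope complex_scope.

Lemma xi_expE (R : realType) (c n : nat) :
  xi R c ^+ n = cos (2 * pi / c%:R *+ n) +i* sin (2 * pi / c%:R *+ n).
Proof.
elim: n => [|n IHn]; first by rewrite expr0 mulr0n cos0 sin0.
rewrite exprS IHn (mulrS _ n) cosD sinD.
apply/eqP; rewrite eq_complex /=; apply/andP; split; apply/eqP; ring.
Qed.

Lemma xi_prim_root (R : realType) (c : nat) :
  (0 < c)%N -> c.-primitive_root (xi R c).
Proof.
move=> c_gt0; have cR : (c%:R : R) != 0 by rewrite pnatr_eq0 -lt0n.
apply/andP; split=> //; apply/forallP => i; rewrite unity_rootE xi_expE.
have [->|neq_ic] := eqVneq i.+1 c.
  rewrite -(mulr_natr (2 * pi / c%:R)) divfK // mulrC mulr_natr cos2pi sin2pi.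
  by rewrite eqxx.
have lt_ic : (i.+1 < c)%N by rewrite ltn_neqAle neq_ic ltn_ord.
apply/eqP/negbTE; rewrite eq_complex /= negb_and; apply/orP; left.
(* Half the angle of [xi R c ^+ i.+1]: it lies strictly between 0 and pi, so [sin x > 0] and the
   real part cos(2x) = 1 - 2 sin(x)^2 is not 1. *)
set x : R := pi * (i.+1%:R / c%:R).
have -> : 2 * pi / c%:R *+ i.+1 = x *+ 2.
  by rewrite /x -(mulr_natr _ i.+1) -(mulr_natr _ 2); field.
have sx_gt0 : 0 < sin x.
  apply: sin_gt0_pi; apply/andP; split.
    by rewrite mulr_gt0 ?pi_gt0 // divr_gt0 ?ltr0n.
  by rewrite gtr_pMr ?pi_gt0 // ltr_pdivrMr ?ltr0n // mul1r ltr_nat.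
have := cos2Dsin2 x; rewrite cos_mulr2n => h.
by apply/eqP; nra.
Qed.

Section Sawtooth.
Variables (F : numFieldType) (c : nat) (z : F).
Hypothesis prim_z : c.-primitive_root z.

Definition sawtooth (t : int) : F :=
  \sum_(1 <= j < c) z ^ (j%:Z * t) / (1 - z ^+ j).

Lemma prim_root_sub1_neq0 (n : nat) : ~~ (c %| n)%N -> 1 - z ^+ n != 0.
Proof. by rewrite (prim_order_dvd prim_z) subr_eq0 eq_sym. Qed.

Lemma prim_root_sub1_lt_neq0 (j : nat) : (0 < j < c)%N -> 1 - z ^+ j != 0.
Proof. by case/andP=> j0 jc; apply: prim_root_sub1_neq0; rewrite gtnNdvd. Qed.

Lemma prim_root_sub1_coprime_neq0 (j e : nat) :
  (0 < j < c)%N -> coprime c e -> 1 - z ^+ (j * e) != 0.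
Proof.
case/andP=> j0 jc cop; apply: prim_root_sub1_neq0.
by rewrite Gauss_dvdl // gtnNdvd.
Qed.

Lemma prim_root_neq0 : z != 0.
Proof. by rewrite (prim_root_eq0 prim_z) -lt0n (prim_order_gt0 prim_z). Qed.

Lemma exprz_prim_root_period (j : nat) (t q : int) :
  z ^ (j%:Z * (t + q * c%:Z)) = z ^ (j%:Z * t).
Proof.
have z0 := prim_root_neq0.
rewrite mulrDr expfzDr // mulrA [_ * c%:Z]mulrC -(exprz_exp z c%:Z) -exprnP.
by rewrite (prim_expr_order prim_z) exp1rz mulr1.
Qed.

Lemma sawtooth_period (t q : int) : sawtooth (t + q * c%:Z) = sawtooth t.
Proof. by apply: eq_bigr => j _; rewrite exprz_prim_root_period. Qed.

(** Multiplied by the nonzero 1 - z^k, the sum over 0 <= j < c telescopes to 1 - z^(kc) = 0;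
    dropping the term j = 0, which is 1, leaves -1. *)
Lemma sum_prim_root_pow (k : nat) : (0 < k < c)%N ->
  \sum_(1 <= j < c) z ^+ (j * k) = -1.
Proof.
move=> kc; have c0 := prim_order_gt0 prim_z.
have h : \sum_(0 <= j < c) z ^+ (j * k) = 0.
  apply: (mulfI (prim_root_sub1_lt_neq0 _ kc)); rewrite mulr0 big_mkord.
  under eq_bigr => j _ do rewrite mulnC exprM.
  rewrite -opprB mulNr -subrX1 -exprM mulnC exprM (prim_expr_order prim_z).
  by rewrite expr1n subrr oppr0.
by move: h; rewrite big_ltn // mul0n expr0 => /eqP; rewrite addrC addr_eq0 => /eqP.
Qed.

Lemma sawtooth1 : sawtooth 1 = - (c.-1%:R / 2).
Proof.
have z0 := prim_root_neq0.
suff h : sawtooth 1 + sawtooth 1 = - c.-1%:R.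
  by rewrite -mulNr -h; field.
(* Reversing the second copy pairs j with c - j; each of the c - 1 pairs contributes -1. *)
rewrite {2}/sawtooth big_nat_rev /= -big_split /=.
rewrite (eq_big_nat _ _ (F2 := fun=> -1)).
  by rewrite sumr_const_nat mulNrn subn1.
move=> j jc; rewrite !mulr1 -!exprnP add1n subSS.
have jc' : (0 < c - j < c)%N by lia.
have hj := prim_root_sub1_lt_neq0 _ jc.
have hj' := prim_root_sub1_lt_neq0 _ jc'.
have e : z ^+ j * z ^+ (c - j) = 1.
  by rewrite -exprD subnKC ?(prim_expr_order prim_z) // ltnW //; case/andP: jc.
move: hj hj' e; set x := z ^+ j; set y := z ^+ (c - j) => hj hj' e.
apply: (mulfI (mulf_neq0 hj hj')).
(* With denominators cleared, both sides become x + y - 2 because xy = 1. *)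
have -> : (1 - x) * (1 - y) * (x / (1 - x) + y / (1 - y))
        = x + y - 2 * (x * y) by field; rewrite hj hj'.
have -> : (1 - x) * (1 - y) * -1 = x + y - 1 - x * y by ring.
by rewrite e; ring.
Qed.

Lemma sawtoothS (r : nat) : (r < c)%N -> sawtooth r.+1%:Z = r%:R - c.-1%:R / 2.
Proof.
elim: r => [_|r IHr rc]; first by rewrite sawtooth1 sub0r.
have -> : sawtooth r.+2%:Z = sawtooth r.+1%:Z + 1.
  (* The quotients at r + 2 and r + 1 differ by -z^(j(r+1)), and these differences sum to 1. *)
  have := sum_prim_root_pow r.+1 rc.
  move/(congr1 -%R); rewrite opprK => <-.
  rewrite /sawtooth -sumrN -big_split /=; apply: eq_big_nat => j jc.
  rewrite -!PoszM -!exprnP mulnS exprD.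
  by have hj := prim_root_sub1_lt_neq0 _ jc; field.
by rewrite IHr ?(ltnW rc) // -(natr1 r); ring.
Qed.

Lemma sawtooth_bound (t : int) : `|sawtooth t| <= c.-1%:R / 2.
Proof.
have c0 := prim_order_gt0 prim_z.
(* The representative of t modulo c is taken in 1..c, the range of [sawtoothS]; hence r is the
   residue of t - 1. *)
have [r rc ->] : exists2 r : nat, (r < c)%N & sawtooth t = sawtooth r.+1%:Z.
  have hr : (0 <= (t - 1) %% c%:Z)%Z by rewrite modz_ge0 //; lia.
  have hc : ((t - 1) %% c%:Z < c%:Z)%Z by rewrite ltz_pmod //; lia.
  exists `|((t - 1) %% c%:Z)%Z|%N; first by lia.
  rewrite -[RHS](sawtooth_period _ ((t - 1) %/ c%:Z)%Z); congr sawtooth.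
  by have := divz_eq (t - 1) c%:Z; lia.
have rc' : (r <= c.-1)%N by lia.
(* The order on [F] is only partial, so the value must be shown real before the norm bound splits in
   two. *)
rewrite sawtoothS // real_ler_norml; last first.
  by rewrite rpredB ?realn // rpredM ?rpredV ?realn.
by rewrite lerBrDl subrr ler0n /= lerBlDr -splitr ler_nat.
Qed.

(** Since z^(j(t+e)) - z^(jt) = -z^(jt) (1 - z^(je)), the second factor cancels. The multiple of c
    is invisible by periodicity; with q = 1 it absorbs the modulus in the shift a + b. *)
Lemma sawtooth_shift (e : nat) (t q : int) : coprime c e ->
  \sum_(1 <= j < c)
     z ^ (j%:Z * (t + e%:Z + q * c%:Z)) / ((1 - z ^+ j) * (1 - z ^+ (j * e)))
  - \sum_(1 <= j < c) z ^ (j%:Z * t) / ((1 - z ^+ j) * (1 - z ^+ (j * e)))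
  = - sawtooth t.
Proof.
move=> cop; rewrite /sawtooth -!sumrN -big_split /=; apply: eq_big_nat => j jc.
have z0 := prim_root_neq0.
have hj := prim_root_sub1_lt_neq0 _ jc.
have hje := prim_root_sub1_coprime_neq0 _ _ jc cop.
rewrite exprz_prim_root_period mulrDr expfzDr // -PoszM -exprnP.
by field; rewrite hj hje.
Qed.

End Sawtooth.

Lemma fourier_dedekindC (R : realType) (e1 e2 c : nat) (n : int) :
  fourier_dedekind R e1 e2 c n = fourier_dedekind R e2 e1 c n.
Proof.
rewrite /fourier_dedekind; congr (_ * _).
by apply: eq_bigr => j _; rewrite [(1 - _) * _]mulrC.
Qed.

Lemma fourier_dedekind_modulus1 (R : realType) (e1 e2 : nat) (n : int) :
  fourier_dedekind R e1 e2 1 n = 0.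
Proof. by rewrite /fourier_dedekind big_geq // mulr0. Qed.

Lemma fourier_dedekind_shift_bound (R : realType) (c e : nat) (t : int) :
  (0 < c)%N -> coprime c e ->
  `|fourier_dedekind R 1 e c (t + e%:Z + c%:Z) - fourier_dedekind R 1 e c t|
    <= 2^-1 - 2^-1 * c%:R^-1.
Proof.
move=> c0 cop; have prim_xi := xi_prim_root R c c0.
have cR : (c%:R : R[i]) != 0 by rewrite pnatr_eq0 -lt0n.
have := sawtooth_shift _ _ _ prim_xi e t 1 cop; rewrite mul1r.
rewrite /fourier_dedekind -mulrBr.
under [X in X - _ = _ -> _]eq_bigr => j _ do rewrite -[in X in _ / (X * _)](muln1 j).
under [X in _ - X = _ -> _]eq_bigr => j _ do rewrite -[in X in _ / (X * _)](muln1 j).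
move=> ->; rewrite normrM normrN normfV normr_nat.
rewrite ler_pdivrMl ?ltr0n //.
apply: le_trans (sawtooth_bound _ _ _ prim_xi t) _.
rewrite -subn1 natrB // le_eqVlt; apply/orP; left; apply/eqP.
by field.
Qed.

(* The inequality is in the order of R[i], where x <= y means that
   Im x = Im y and Re x <= Re y; both sides are real. *)
Theorem theorem36 (R : realType) (a b : nat)
    (ha : (0 < a)%N) (hb : (0 < b)%N) (hab : coprime a b) (t : int) :
  `| fourier_dedekind_sum R a b (t + a%:Z + b%:Z) - fourier_dedekind_sum R a b t |
    <= 1 - 2%:R^-1 * (a%:R^-1 + b%:R^-1).
Proof.
have hba : coprime b a by rewrite coprime_sym.
have boundA := fourier_dedekind_shift_bound R a b t ha hab.
have boundB := fourier_dedekind_shift_bound R b a t hb hba.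
rewrite addrAC in boundA.
rewrite /fourier_dedekind_sum !fourier_dedekind_modulus1 !addr0.
(* Swapping the parameters 1 and a gives the modulus-b sums the form of [boundB]; regrouping by
   modulus prepares the triangle inequality. *)
rewrite ![fourier_dedekind R a 1 b _]fourier_dedekindC opprD addrACA.
apply: le_trans (ler_normD _ _) _.
apply: le_trans (lerD boundA boundB) _.
rewrite le_eqVlt; apply/orP; left; apply/eqP.
have aR : (a%:R : R[i]) != 0 by rewrite pnatr_eq0 -lt0n.
have bR : (b%:R : R[i]) != 0 by rewrite pnatr_eq0 -lt0n.
by field; rewrite aR bR.
Qed.
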